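(* Let $(\mathcal{X},d_{\mathcal{X}})$ and $(\mathcal{Y},d_{\mathcal{Y}})$ be separable metric spaces of negative type, as witnessed by isometric embeddings $\phi:(\mathcal{X},d_{\mathcal{X}}^{1/2})\to\mathcal{H}_1$ and $\psi:(\mathcal{Y},d_{\mathcal{Y}}^{1/2})\to\mathcal{H}_2$ into two separable Hilbert spaces with the same scalar field. If $\theta\in M_1^{1,1}(\mathcal{X}\times\mathcal{Y})$ has marginals $\mu\in M_1^1(\mathcal{X})$ and $\nu\in M_1^1(\mathcal{Y})$, then $$dcov(\theta)=4\|\beta_{\phi\otimes\psi}(\theta-\mu\times\nu)\|_{\mathcal{H}_1\otimes\mathcal{H}_2}^2=4\Big\|\int\phi\otimes\psi\,d\theta-\int\phi\otimes\psi\,d(\mu\times\nu)\Big\|_{\mathcal{H}_1\otimes\mathcal{H}_2}^2 .$$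
   Context: Scalar fields are $\mathbb{R}$ or $\mathbb{C}$. A metric space is of negative type if $\sum_{i,j=1}^n\alpha_i\alpha_j d(x_i,x_j)\le 0$ for all $n\in\mathbb{N}$, points $x_1,\dots,x_n$ and $\alpha\in\mathbb{R}^n$ with $\sum_i\alpha_i=0$. An isometric embedding $\phi:(\mathcal{X},d_{\mathcal{X}}^{1/2})\to\mathcal{H}$ is a map with $d_{\mathcal{X}}(x,x')=\|\phi(x)-\phi(x')\|_{\mathcal{H}}^2$ for all $x,x'$. $M_1^1(\mathcal{X})$ is the set of Borel probability measures $\mu$ on $\mathcal{X}$ with finite first moment, i.e. $\int d_{\mathcal{X}}(x,o)\,d\mu(x)<\infty$ for some (equivalently every) $o\in\mathcal{X}$; $M^1(\mathcal{X})$ is the set of finite signed Borel measures $\mu$ with $\int d_{\mathcal{X}}(x,o)\,d|\mu|(x)<\infty$, where $|\mu|$ is the total variation. $M^{1,1}(\mathcal{X}\times\mathcal{Y})$ is the set of finite signed measures $\theta$ on $\mathcal{B}(\mathcal{X})\otimes\mathcal{B}(\mathcal{Y})$ such that the marginals of $|\theta|$ lie in $M^1(\mathcal{X})$ and $M^1(\mathcal{Y})$; $M_1^{1,1}(\mathcal{X}\times\mathcal{Y})$ is its subset of probability measures. For $\mu\in M^1(\mathcal{X})$: $a_\mu(x)=\int d_{\mathcal{X}}(x,y)\,d\mu(y)$, $D(\mu)=\int a_\mu\,d\mu$, $d_\mu(x_1,x_2)=d_{\mathcal{X}}(x_1,x_2)-a_\mu(x_1)-a_\mu(x_2)+D(\mu)$,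 and analogously for $\nu$ on $\mathcal{Y}$. For $\theta\in M_1^{1,1}(\mathcal{X}\times\mathcal{Y})$ with marginals $\mu,\nu$, $$dcov(\theta)=\int d_\mu(x_1,x_2)\,d_\nu(y_1,y_2)\,d(\theta\times\theta)((x_1,y_1),(x_2,y_2)).$$ $\mathcal{H}_1\otimes\mathcal{H}_2$ is the Hilbert space tensor product (completed), and $\phi\otimes\psi(x,y)=\phi(x)\otimes\psi(y)$. For a Hilbert-space valued map $f$ and a finite signed measure $m$, $\int f\,dm$ denotes the Pettis integral: the unique element of the Hilbert space with $h^*(\int f\,dm)=\int h^*\circ f\,dm$ for every continuous linear functional $h^*$. $\beta_{\phi\otimes\psi}:M^{1,1}(\mathcal{X}\times\mathcal{Y})\to\mathcal{H}_1\otimes\mathcal{H}_2$ is defined by $\beta_{\phi\otimes\psi}(\theta)=\int\phi\otimes\psi\,d\theta$ (this Pettis integral exists).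
   Formalization: For complex scalars the tensor product is that of the underlying real Hilbert spaces (inner product Re·Re); over C the identity fails, e.g. cube roots of unity with d=|x−y|², inclusions, θ uniform on the diagonal: dcov=2 but the right side is 0. *)

(* Defs.v *)
From HB Require Import structures.
From mathcomp Require Import all_boot all_order all_algebra.
From mathcomp Require Import complex.
From mathcomp Require Import all_classical all_reals all_analysis.

Set Implicit Arguments.
Unset Strict Implicit.
Unset Printing Implicit Defensive.
Import Order.TTheory GRing.Theory Num.Theory.
Import numFieldNormedType.Exports.

Local Open Scope classical_set_scope.
Local Open Scope ring_scope.

Inductive scalar_kind := RealScalars | ComplexScalars.

Definition scalar_field (R : realType) (k : scalar_kind) : numFieldType :=
  match k with
  | RealScalars => R
  | ComplexScalars => R[i]%C
  end.

Section scalar.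
Variable R : realType.

Definition sconj (k : scalar_kind) : scalar_field R k -> scalar_field R k :=
  match k with
  | RealScalars => fun a => a
  | ComplexScalars => fun z => conjc z
  end.

Definition sRe (k : scalar_kind) : scalar_field R k -> R :=
  match k with
  | RealScalars => fun a => a
  | ComplexScalars => fun z => complex.Re z
  end.

Definition sIm (k : scalar_kind) : scalar_field R k -> R :=
  match k with
  | RealScalars => fun=> 0
  | ComplexScalars => fun z => complex.Im z
  end.

Definition mkscalar (k : scalar_kind) : R -> R -> scalar_field R k :=
  match k with
  | RealScalars => fun a _ => a
  | ComplexScalars => fun a b => Complex a b
  end.

End scalar.

HB.mixin Record NormedModule_isHilbert (R : realType) (k : scalar_kind) H
    & NormedModule (scalar_field R k) H := {
  inner : {dot H for @sconj R k} ;
  inner_normE : forall x : H, inner x x = `|x| ^+ 2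
}.

#[short(type="hilbertType")]
HB.structure Definition Hilbert (R : realType) (k : scalar_kind) :=
  {H of CompleteNormedModule (scalar_field R k) H
      & NormedModule_isHilbert R k H}.

(* The library's sigma-algebras live on pointed types only.  Nothing below
   depends on the chosen point. *)
#[short(type="pmetricType")]
HB.structure Definition PointedMetric (K : numDomainType) :=
  {M of Metric K M & isPointed M}.

Definition borel (R : realType) (X : pmetricType R) :=
  g_sigma_algebraType (@open X).

Definition separable_space (T : topologicalType) : Prop :=
  exists2 D : set T, countable D & dense D.

Definition negative_type (R : realType) (X : metricType R) : Prop :=
  forall (n : nat) (x : 'I_n -> X) (a : 'I_n -> R), \sum_i a i = 0 ->
    \sum_i \sum_j a i * a j * mdist (x i) (x j) <= 0.

Section hilbert.
Context {R : realType} {k : scalar_kind}.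

(* In a normed module over [R[i]] the norm is itself an element of [R[i]]. *)
Definition hnorm (H : hilbertType R k) (x : H) : R := sRe `|x|.

Definition sqrt_isometric_embedding (X : metricType R) (H : hilbertType R k)
    (phi : X -> H) : Prop :=
  forall x y, mdist x y = hnorm (phi x - phi y) ^+ 2.

Definition re_inner (H : hilbertType R k) (x y : H) : R := sRe (inner x y).

Definition real_bilinear (H1 H2 : hilbertType R k)
    (HT : hilbertType R RealScalars) (tens : H1 -> H2 -> HT) : Prop :=
  (forall (a : R) (u u' : H1) (v : H2),
    tens (mkscalar k a 0 *: u + u') v =
      mkscalar RealScalars a 0 *: tens u v + tens u' v) /\
  (forall (a : R) (u : H1) (v v' : H2),
    tens u (mkscalar k a 0 *: v + v') =
      mkscalar RealScalars a 0 *: tens u v + tens u v').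

(* [HT] together with [tens] is the completion of the algebraic tensor product
   of the real Hilbert spaces underlying [H1] and [H2], for the inner product
   determined by its values on elementary tensors; this fixes it up to a
   unique unitary isomorphism compatible with the elementary tensors.
   For [k = RealScalars] it is the usual Hilbert tensor product of [H1] and
   [H2].  For complex spaces the tensor product has to be taken over the reals:
   if [X = Y] consists of the cube roots of unity in the complex plane with
   [d x y = `|x - y| ^+ 2], [phi] and [psi] are the inclusions and [theta] is
   uniform on the diagonal, then [dcov theta = 2], whereas
   [\int phi * psi] vanishes for [theta] and for the product of its
   marginals, so the identity fails in the tensor product over the complex
   numbers. *)
Definition is_hilbert_tensor (H1 H2 : hilbertType R k)
    (HT : hilbertType R RealScalars) (tens : H1 -> H2 -> HT) : Prop :=
  [/\ real_bilinear tens,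
      forall u1 v1 u2 v2, inner (tens u1 v1) (tens u2 v2) =
        mkscalar RealScalars (re_inner u1 u2 * re_inner v1 v2) 0
    & dense [set z : HT | exists n (u : 'I_n -> H1) (v : 'I_n -> H2),
               z = \sum_(i < n) tens (u i) (v i)]].

End hilbert.

Section signed_measure.
Context {d} {T : measurableType d} {R : realType}.
Implicit Type m : {charge set T -> \bar R}.

Definition csub (m1 m2 : {charge set T -> \bar R}) :
  {charge set T -> \bar R} := cadd m1 (copp m2).

Lemma hahn_exists m :
  exists PN : set T * set T, hahn_decomposition m PN.1 PN.2.
Proof. by have [P [N PN]] := Hahn_decomposition m; exists (P, N). Qed.

(* Jordan parts and total variation do not depend on the Hahn decomposition
   picked here: see [Hahn_decomposition_uniq]. *)
Definition hahn m := projT2 (cid (hahn_exists m)).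

Definition pos_part m : {measure set T -> \bar R} := jordan_pos (hahn m).

Definition neg_part m : {measure set T -> \bar R} := jordan_neg (hahn m).

Definition total_variation m : {measure set T -> \bar R} :=
  charge_variation (hahn m).

Definition signed_integrable m (f : T -> R) : Prop :=
  (total_variation m).-integrable setT (EFin \o f).

Definition signed_integral m (f : T -> R) : R :=
  \int[pos_part m]_x f x - \int[neg_part m]_x f x.

Definition scalar_integrable (k : scalar_kind) m
    (f : T -> scalar_field R k) : Prop :=
  signed_integrable m (@sRe R k \o f) /\ signed_integrable m (@sIm R k \o f).

Definition scalar_integral (k : scalar_kind) m (f : T -> scalar_field R k) :
    scalar_field R k :=
  mkscalar k (signed_integral m (@sRe R k \o f))
             (signed_integral m (@sIm R k \o f)).

Definition is_pettis_integral (k : scalar_kind) (H : hilbertType R k) m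
    (f : T -> H) (v : H) : Prop :=
  forall h : {linear H -> (scalar_field R k)^o}, continuous h ->
    scalar_integrable m (h \o f) /\ h v = scalar_integral m (h \o f).

Definition pettis_integral (k : scalar_kind) (H : hilbertType R k) m
    (f : T -> H) : H := get (is_pettis_integral m f).

End signed_measure.

Definition prod_probability d1 d2 (T1 : measurableType d1)
    (T2 : measurableType d2) (R : realType) (P1 : probability T1 R)
    (P2 : probability T2 R) : probability (T1 * T2)%type R := (P1 \x P2)%E.

Section marginals.
Context {d1 d2} {T1 : measurableType d1} {T2 : measurableType d2}.
Context {R : realType}.
Variable m : {measure set (T1 * T2)%type -> \bar R}.

(* The measure structure of [pushforward m f] takes a proof that [f] is
   measurable, which cannot be inferred, hence the explicit instance. *)
Definition fst_marginal : {measure set T1 -> \bar R} :=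
  measure_function_pushforward__canonical__measure_function_Measure
    m measurable_fst.

Definition snd_marginal : {measure set T2 -> \bar R} :=
  measure_function_pushforward__canonical__measure_function_Measure
    m measurable_snd.

End marginals.

Section distance_covariance.
Context {R : realType}.

Definition finite_first_moment (X : pmetricType R)
    (m : {measure set (borel X) -> \bar R}) : Prop :=
  exists o : X, (\int[m]_x (mdist (x : X) o)%:E < +oo)%E.

Definition in_M11 (X Y : pmetricType R)
    (m : {charge set (borel X * borel Y)%type -> \bar R}) : Prop :=
  finite_first_moment (fst_marginal (total_variation m)) /\
  finite_first_moment (snd_marginal (total_variation m)).

Definition mean_dist (X : pmetricType R)
    (m : {measure set (borel X) -> \bar R}) (x : X) : R :=
  \int[m]_y mdist x (y : X).

Definition mean_mean_dist (X : pmetricType R)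
    (m : {measure set (borel X) -> \bar R}) : R :=
  \int[m]_x mean_dist m (x : X).

Definition centered_dist (X : pmetricType R)
    (m : {measure set (borel X) -> \bar R}) (x1 x2 : X) : R :=
  mdist x1 x2 - mean_dist m x1 - mean_dist m x2 + mean_mean_dist m.

Definition dcov (X Y : pmetricType R)
    (theta : probability (borel X * borel Y)%type R) : R :=
  \int[(theta \x theta)%E]_z
    (centered_dist (fst_marginal theta) z.1.1 z.2.1 *
     centered_dist (snd_marginal theta) z.1.2 z.2.2).

Definition beta_tensor (k : scalar_kind) (X Y : pmetricType R)
    (H1 H2 : hilbertType R k) (HT : hilbertType R RealScalars)
    (tens : H1 -> H2 -> HT) (phi : X -> H1) (psi : Y -> H2)
    (m : {charge set (borel X * borel Y)%type -> \bar R}) : HT :=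
  pettis_integral m (fun z : borel X * borel Y => tens (phi z.1) (psi z.2)).

End distance_covariance.

(* Main.v *)
From HB Require Import structures.
Require Import Defs.
From mathcomp Require Import all_boot all_order all_algebra.
From mathcomp Require Import complex.
From mathcomp Require Import all_classical all_reals all_analysis.
From mathcomp Require Import measurable_realfun.
From mathcomp Require Import ring lra.
Set Implicit Arguments.
Unset Strict Implicit.
Unset Printing Implicit Defensive.
Import Order.TTheory GRing.Theory Num.Theory.
Import numFieldNormedType.Exports.
Local Open Scope classical_set_scope.
Local Open Scope ring_scope.

(** Why the identity holds.  Write [m] and [n] for the means of [phi] under [mu]
    and of [psi] under [nu].  Expanding [mdist x y = |phi x - phi y|^2] around
    [m] shows that the double centring of the metric is exactly the Gram kernel
    of the centred embedding:
      [centered_dist mu x1 x2 = - 2 <phi x1 - m, phi x2 - m>]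
    ([centered_distE]).  Hence the integrand of [dcov theta] is four times
    [<g z1, g z2>], where [g (x, y) = (phi x - m) (x) (psi y - n)], and Fubini's
    theorem identifies its integral with [4 |b|^2], where [b] is the weak integral
    of [g] under [theta] ([hnorm_tensor_integral]).  Expanding the product [g] and
    integrating one factor at a time gives
      [b = \int phi (x) psi d theta - m (x) n] ([centered_tensor_integral]),
    and [m (x) n] is the integral of [phi (x) psi] under [mu \x nu]
    ([tensor_integral_prod]), so [b] is the Pettis integral of [phi (x) psi] for
    the signed measure [theta - mu \x nu] ([pettis_integral_diff]).

    Three facts carry the argument.  Integrals of Hilbert-valued maps exist
    because a bounded functional is represented by a vector ([riesz]); everything
    is phrased with the real part of the inner product, so that real and complex
    scalars are treated alike.  Kernels such as [<w, phi x (x) psi y>] are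
    measurable for the product of the Borel sigma-algebras because in separable
    metric spaces countably many balls generate the open sets
    ([measurable_mdist_open_prod]).  They are integrable because
    [|phi x| |psi y|] is at most [|phi x|^2 + |psi y|^2], whose two terms have
    finite integrals exactly by the first moment conditions
    ([integrable_hnorm_sq]). *)

(** * Scalars: real parts and the embedding of the reals *)

Section scalars.
Context {R : realType} {k : scalar_kind}.
Implicit Types (a b : R) (z w : scalar_field R k).

Lemma sReD z w : sRe (z + w) = sRe z + sRe w.
Proof. by case: k z w => // -[a b] [c d]. Qed.

Lemma sRe_mkscalarM a z : sRe (mkscalar k a 0 * z) = a * sRe z.
Proof. by case: k z => // -[c d] /=; rewrite mul0r subr0. Qed.

Lemma sRe_conj z : sRe (sconj z) = sRe z.
Proof. by case: k z => // -[]. Qed.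

Lemma mkscalarB a b : mkscalar k (a - b) 0 = mkscalar k a 0 - mkscalar k b 0.
Proof. by case: k => //=; congr Complex; rewrite ?oppr0 ?addr0. Qed.

Lemma mkscalar1 : mkscalar k (1 : R) 0 = 1.
Proof. by case: k. Qed.

Lemma sRe_ge0 z : 0 <= z -> 0 <= sRe z.
Proof. by case: k z => // -[a b]; rewrite lecE => /andP[]. Qed.

Lemma ge0_mkscalar z : 0 <= z -> z = mkscalar k (sRe z) 0.
Proof. by case: k z => // -[a b]; rewrite lecE => /andP[/eqP/= ->]. Qed.

Lemma sRe_mkscalar a : sRe (mkscalar k a 0) = a.
Proof. by case: k. Qed.

Lemma ltr_mkscalar a b : (mkscalar k a 0 < mkscalar k b 0) = (a < b).
Proof. by case: k => //=; rewrite ltcR. Qed.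

Lemma ler_mkscalar a b : (mkscalar k a 0 <= mkscalar k b 0) = (a <= b).
Proof. by case: k => //=; rewrite lecR. Qed.

Lemma mkscalar0 : mkscalar k (0 : R) 0 = 0.
Proof. by case: k. Qed.

Lemma mkscalarD a b : mkscalar k (a + b) 0 = mkscalar k a 0 + mkscalar k b 0.
Proof. by case: k => //=; congr Complex; rewrite ?addr0. Qed.

Lemma mkscalarM a b : mkscalar k (a * b) 0 = mkscalar k a 0 * mkscalar k b 0.
Proof. by case: k => //=; congr Complex; rewrite ?(mulr0, mul0r, subr0, addr0). Qed.
End scalars.
(** * Real inner product geometry and the Riesz representation *)

Section re_inner.
Context {R : realType} {k : scalar_kind} {H : hilbertType R k}.
Implicit Types (u v w x y : H) (a b : R).

Local Notation "a *r u" := (mkscalar k a 0 *: u) (at level 40).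

Lemma re_innerC u v : re_inner u v = re_inner v u.
Proof. by rewrite /re_inner hermitian_subproof expr0 mul1r sRe_conj. Qed.

Lemma re_innerDl u v w : re_inner (u + v) w = re_inner u w + re_inner v w.
Proof. by rewrite /re_inner linearDl sReD. Qed.

Lemma re_innerZl a u w : re_inner (a *r u) w = a * re_inner u w.
Proof. by rewrite /re_inner linearZl_LR sRe_mkscalarM. Qed.

Lemma re_innerDr u v w : re_inner w (u + v) = re_inner w u + re_inner w v.
Proof. by rewrite re_innerC re_innerDl !(re_innerC w). Qed.

Lemma re_innerZr a u w : re_inner w (a *r u) = a * re_inner w u.
Proof. by rewrite re_innerC re_innerZl re_innerC. Qed.

Lemma scaleN1_real u : (- 1) *r u = - u.
Proof. by rewrite -[-1]add0r mkscalarB mkscalar0 mkscalar1 sub0r scaleN1r. Qed.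

Lemma re_innerNl u w : re_inner (- u) w = - re_inner u w.
Proof. by rewrite -scaleN1_real re_innerZl mulN1r. Qed.

Lemma re_innerNr u w : re_inner w (- u) = - re_inner w u.
Proof. by rewrite re_innerC re_innerNl re_innerC. Qed.

Lemma re_innerBl u v w : re_inner (u - v) w = re_inner u w - re_inner v w.
Proof. by rewrite re_innerDl re_innerNl. Qed.

Lemma re_innerBr u v w : re_inner w (u - v) = re_inner w u - re_inner w v.
Proof. by rewrite re_innerDr re_innerNr. Qed.

Lemma re_inner0r u : re_inner u 0 = 0.
Proof. by rewrite -(subrr (0 : H)) re_innerBr subrr. Qed.

Lemma normE_hnorm u : `|u| = mkscalar k (hnorm u) 0.
Proof. exact: ge0_mkscalar. Qed.

Lemma hnorm_ge0 u : 0 <= hnorm u.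
Proof. exact: sRe_ge0. Qed.

Lemma re_inner_sq u : re_inner u u = hnorm u ^+ 2.
Proof.
by rewrite /re_inner inner_normE normE_hnorm expr2 -mkscalarM sRe_mkscalar.
Qed.

Lemma re_inner_ge0 u : 0 <= re_inner u u.
Proof. by rewrite re_inner_sq sqr_ge0. Qed.

Lemma hnorm_eq0 u : hnorm u = 0 -> u = 0.
Proof.
by move=> u0; apply/eqP; rewrite -normr_eq0 normE_hnorm u0 mkscalar0.
Qed.

Lemma hnorm_opp u : hnorm (- u) = hnorm u.
Proof. by rewrite /hnorm normrN. Qed.

Lemma ler_hnormD u v : hnorm (u + v) <= hnorm u + hnorm v.
Proof.
by have := ler_normD u v; rewrite !normE_hnorm -mkscalarD ler_mkscalar.
Qed.

Lemma re_inner_eq0 u : (forall w, re_inner w u = 0) -> u = 0.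
Proof.
move=> /(_ u); rewrite re_inner_sq => /eqP.
by rewrite sqrf_eq0 => /eqP; exact: hnorm_eq0.
Qed.

Lemma cauchy_schwarz u v : `|re_inner u v| <= hnorm u * hnorm v.
Proof.
rewrite -ler_sqr ?nnegrE ?mulr_ge0 ?hnorm_ge0//.
rewrite real_normK ?num_real// exprMn -!re_inner_sq.
have [v0|v0] := eqVneq (hnorm v) 0.
  by rewrite (hnorm_eq0 v0) !re_inner0r expr0n/= mulr0.
set a := re_inner u u; set b := re_inner u v; set c := re_inner v v.
have c0 : 0 < c by rewrite /c re_inner_sq exprn_gt0// lt_neqAle eq_sym v0 hnorm_ge0.
have := re_inner_ge0 (c *r u - b *r v).
rewrite !(re_innerBl, re_innerBr, re_innerZl, re_innerZr) -/a -/b -/c.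
rewrite (re_innerC v u) -/b => h.
by rewrite -(ler_pM2l c0); nra.
Qed.

(** Completeness is stated for balls whose radius is a scalar, possibly complex;
    a positive complex number is real, so it amounts to real radii. *)
Lemma hilbert_complete (f : nat -> H) :
  (forall e : R, 0 < e -> exists N, forall m n, (N <= m)%N -> (N <= n)%N ->
    hnorm (f m - f n) < e) ->
  exists v, forall e : R, 0 < e -> exists N, forall n, (N <= n)%N ->
    hnorm (v - f n) < e.
Proof.
move=> fC.
have hlt e : 0 < e -> 0 < sRe e /\ e = mkscalar k (sRe e) 0.
  move=> e0; have eE := ge0_mkscalar (ltW e0); split => //.
  by move: e0; rewrite {1}eE -mkscalar0 ltr_mkscalar.
have /cvg_ex[v /= vP] : cvg (f @ \oo).
  apply: cauchy_cvg; apply: cauchy_exP => e /hlt[e0 eE].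
  have [N NP] := fC _ e0; exists (f N); exists N => // n /= Nn.
  by rewrite -ball_normE /= normE_hnorm eE ltr_mkscalar NP.
exists v => e e0.
have e0' : 0 < mkscalar k e 0 by rewrite -mkscalar0 ltr_mkscalar.
have [N _ NP] := @cvgr_dist_lt _ _ _ _ _ _ _ vP _ e0'.
exists N => n Nn; have := NP n Nn.
by rewrite /= normE_hnorm ltr_mkscalar.
Qed.

(** The representing vector minimises the energy [J u = |u|^2 - 2 L u], which is
    bounded below because [L] is bounded.  The parallelogram identity turns
    near-minimality into closeness, so a minimising sequence is Cauchy, and the
    first-order condition at its limit is the representation.  Only real-linear
    functionals and real parts of inner products occur, so the statement covers
    the real Hilbert space underlying a complex one. *)
Lemma riesz (L : H -> R) (C : R) :
  (forall u v, L (u + v) = L u + L v) -> (forall a u, L (a *r u) = a * L u) ->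
  (forall u, `|L u| <= C * hnorm u) ->
  exists v, forall u, L u = re_inner u v.
Proof.
move=> LD LZ LC.
pose J u := re_inner u u - 2 * L u.
pose m := inf (range J).
have Jlb : has_inf (range J).
  split; first by exists (J 0), 0.
  exists (- C ^+ 2) => _ [u _ <-]; rewrite /J re_inner_sq.
  by have := sqr_ge0 (hnorm u - C); have := LC u; rewrite ler_norml => /andP[_]; nra.
have mJ u : m <= J u by apply: (ge_inf Jlb.2); exists u.
have ex_min n : exists u, J u < m + n.+1%:R^-1.
  have [|_ [u _ <-] ?] := @inf_adherent _ (range J) n.+1%:R^-1 _ Jlb.
    by rewrite invr_gt0.
  by exists u.
have /choice[f fP] := ex_min.
have JZ u w t : J (u + t *r w) =
    J u + 2 * t * (re_inner w u - L w) + t ^+ 2 * re_inner w w.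
  rewrite /J !(re_innerDl, re_innerDr, re_innerZl, re_innerZr) LD LZ.
  rewrite (re_innerC u w); ring.
have small_inv (e : R) : 0 < e -> exists N, forall n, (N <= n)%N -> n.+1%:R^-1 < e.
  by move=> e0; have [N _ NP] := near_infty_natSinv_lt (PosNum e0); exists N.
have mid u w : 2 * J (u + 2^-1 *r w) = J u + J (u + 1 *r w) - 2^-1 * re_inner w w.
  by rewrite !JZ; field.
clearbody m J.
have [|v vP] := @hilbert_complete f.
  move=> e e0; have [|N NP] := small_inv (e ^+ 2 / 4).
    by rewrite divr_gt0// exprn_gt0.
  exists N => p n Np Nn.
  rewrite -ltr_sqr ?nnegrE ?hnorm_ge0 ?(ltW e0)// -re_inner_sq.
  have := mid (f n) (f p - f n); rewrite mkscalar1 scale1r subrKC.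
  have := mJ (f n + 2^-1 *r (f p - f n)).
  have := fP n; have := fP p; have := NP n Nn; have := NP p Np.
  move: n.+1%:R^-1 p.+1%:R^-1 => x y; lra.
exists v => w; apply/eqP; rewrite -subr_eq0 -normr_le0.
have [w0|w0] := eqVneq (hnorm w) 0.
  have := LC w; rewrite (hnorm_eq0 w0) (re_innerC 0) re_inner0r subr0.
  by rewrite -(hnorm_eq0 w0) w0 mulr0.
have W0 : 0 < hnorm w by rewrite lt_neqAle eq_sym w0 hnorm_ge0.
have close (e : R) : 0 < e -> `|L w - re_inner w v| <= 2 * e * hnorm w.
  move=> e0; have [N NP] := vP e e0.
  have [|N' N'P] := small_inv (e ^+ 2); first by rewrite exprn_gt0.
  pose n := maxn N N'.
  have hv := NP n (leq_maxl _ _); have he := N'P n (leq_maxr _ _).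
  set b := re_inner w (f n) - L w.
  have hb : `|b| <= e * hnorm w.
    rewrite -ler_sqr ?nnegrE ?mulr_ge0 ?hnorm_ge0 ?(ltW e0)//.
    rewrite real_normK ?num_real// exprMn.
    (* this step length minimises the energy on the line of direction w *)
    have := mJ (f n + (- b / hnorm w ^+ 2) *r w); rewrite JZ re_inner_sq -/b.
    have -> : J (f n) + 2 * (- b / hnorm w ^+ 2) * b +
        (- b / hnorm w ^+ 2) ^+ 2 * hnorm w ^+ 2 =
        J (f n) - b ^+ 2 / hnorm w ^+ 2 by field.
    have := fP n; move: (J _) n.+1%:R^-1 he => x y he h1 h2.
    rewrite -ler_pdivrMr ?exprn_gt0//; lra.
  have -> : L w - re_inner w v = - b - re_inner (v - f n) w.
    by rewrite (re_innerC (v - f n)) re_innerBr /b; ring.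
  rewrite (le_trans (ler_normB _ _))// normrN.
  have := cauchy_schwarz (v - f n) w.
  have : hnorm (v - f n) * hnorm w <= e * hnorm w by rewrite ler_pM2r// ltW.
  lra.
apply/ler_addgt0Pr => e e0; rewrite add0r.
have := close (e / (2 * hnorm w)); rewrite divr_gt0 ?mulr_gt0// => /(_ isT).
by congr (_ <= _); field.
Qed.
End re_inner.
(** * Measurability on products of separable metric spaces *)

Section continuous_measurable.
Context {R : realType}.
Implicit Types X Y : pmetricType R.

Lemma measurable_mdist_open X (S : set X) :
  (forall x, S x -> exists2 d : R, 0 < d & forall y, mdist x y < d -> S y) ->
  measurable (S : set (borel X)).
Proof.
move=> Sopen; apply: sub_sigma_algebra; rewrite openE => x /Sopen[d d0 dS].
by apply/metricType_numDomainType.nbhs_mdistP; exists d.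
Qed.

Lemma measurable_mdist_ball X (x : X) (r : R) :
  measurable ([set y | mdist x y < r] : set (borel X)).
Proof.
apply: measurable_mdist_open => y /= xyr; exists (r - mdist x y).
  by rewrite subr_gt0.
by move=> z yz; have := metric_triangle x y z; lra.
Qed.

Lemma dense_sequence X : separable_space X ->
  exists s : nat -> X, forall x (e : R), 0 < e -> exists n, mdist x (s n) < e.
Proof.
move=> [D /pcard_injP[f finj] Ddense].
exists (fun n => get [set x | D x /\ f x = n]) => x e e0.
have [| |y [xy Dy]] := Ddense [set y | mdist x y < e].
- by exists x => /=; rewrite mdistxx.
- rewrite openE => y /= xye.
  apply/metricType_numDomainType.nbhs_mdistP; exists (e - mdist x y) => /=.
    by rewrite subr_gt0.
  by move=> z /= yz; have := metric_triangle x y z; lra.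
exists (f y); rewrite (_ : get _ = y)//.
apply: get_unique => // z [Dz fzy]; apply: finj => //; exact/mem_set.
Qed.

(** Every point of [S] lies in a product of balls that is contained in [S], has
    its centres in the dense sequences and radius [1 / (n + 1)].  Hence [S] is a
    countable union of measurable rectangles.  Without separability the product
    of two Borel sigma-algebras can miss open sets. *)
Lemma measurable_mdist_open_prod X Y (S : set (X * Y)) :
  separable_space X -> separable_space Y ->
  (forall x0 y0, S (x0, y0) -> exists2 d : R, 0 < d &
    forall x y, mdist x0 x < d -> mdist y0 y < d -> S (x, y)) ->
  measurable (S : set (borel X * borel Y)).
Proof.
move=> /dense_sequence[s sP] /dense_sequence[t tP] Sopen.
pose r n : R := n.+1%:R^-1.
pose Q i j n : set (borel X * borel Y) :=
  [set x : X | mdist (s i) x < r n] `*` [set y : Y | mdist (t j) y < r n].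
pose A i j n := if `[< Q i j n `<=` S >] then Q i j n else set0.
have -> : S = \bigcup_i \bigcup_j \bigcup_n A i j n.
  apply/seteqP; split => [[x y] Sxy|z [i _ [j _ [n _]]]]; last first.
    by rewrite /A; case: asboolP => // QS /QS.
  have [d d0 dS] := Sopen _ _ Sxy.
  have d20 : 0 < d / 2 by rewrite divr_gt0.
  have [n _ /(_ n (leqnn n))/=] := near_infty_natSinv_lt (PosNum d20).
  have : 0 < r n by rewrite invr_gt0.
  rewrite -/(r n); clearbody r => n0 nd.
  have [i xi] := sP x _ n0; have [j yj] := tP y _ n0.
  exists i => //; exists j => //; exists n => //.
  have QS : Q i j n `<=` S.
    move=> [x' y'] [/= sx' ty']; apply: dS.
      by have := metric_triangle x (s i) x'; lra.
    by have := metric_triangle y (t j) y'; lra.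
  rewrite /A; case: asboolP => // _; split => /=.
    by rewrite metric_sym.
  by rewrite metric_sym.
apply: bigcupT_measurable => i; apply: bigcupT_measurable => j.
apply: bigcupT_measurable => n; rewrite /A; case: ifP => // _.
by apply: measurableX; exact: measurable_mdist_ball.
Qed.

Lemma measurable_fun_mdist X (F : X -> R) :
  (forall x0 (e : R), 0 < e -> exists2 d : R, 0 < d &
    forall x, mdist x0 x < d -> `|F x - F x0| < e) ->
  measurable_fun setT (F : borel X -> R).
Proof.
move=> Fc; apply: (measurability _ (RGenOInfty.measurableE R)) => _ [_ [a ->] <-].
rewrite setTI; apply: measurable_mdist_open => x; rewrite /= in_itv/= andbT => ax.
have [|d d0 dF] := Fc x (F x - a); first by rewrite subr_gt0.
by exists d => // y /dF; rewrite /= in_itv/= andbT ltr_norml => /andP[]; lra.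
Qed.

Lemma measurable_fun_mdist_prod X Y (F : X * Y -> R) :
  separable_space X -> separable_space Y ->
  (forall x0 y0 (e : R), 0 < e -> exists2 d : R, 0 < d &
    forall x y, mdist x0 x < d -> mdist y0 y < d ->
      `|F (x, y) - F (x0, y0)| < e) ->
  measurable_fun setT (F : (borel X * borel Y)%type -> R).
Proof.
move=> sX sY Fc.
apply: (measurability _ (RGenOInfty.measurableE R)) => _ [_ [a ->] <-].
rewrite setTI; apply: measurable_mdist_open_prod => // x y.
rewrite /= in_itv/= andbT => ax.
have [|d d0 dF] := Fc x y (F (x, y) - a); first by rewrite subr_gt0.
exists d => // x' y' xx' yy'; have := dF x' y' xx' yy'.
by rewrite /= in_itv/= andbT ltr_norml => /andP[]; lra.
Qed.
End continuous_measurable.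

Section embedding.
Context {R : realType} {k : scalar_kind} {X : pmetricType R}
  {H : hilbertType R k}.
Variable phi : X -> H.
Hypothesis hphi : sqrt_isometric_embedding phi.

Lemma embedding_continuous x0 (e : R) : 0 < e ->
  exists2 d : R, 0 < d & forall x, mdist x0 x < d -> hnorm (phi x - phi x0) < e.
Proof.
move=> e0; exists (e ^+ 2); first by rewrite exprn_gt0.
move=> x; rewrite hphi -(hnorm_opp (phi x0 - _)) opprB.
by rewrite ltr_sqr ?nnegrE ?hnorm_ge0 ?(ltW e0).
Qed.

Lemma embeddingB (m : H) : sqrt_isometric_embedding (fun x => phi x - m).
Proof. by move=> x y; rewrite hphi opprB addrA subrK. Qed.

Lemma measurable_re_inner_embedding (w : H) :
  measurable_fun setT ((fun x => re_inner w (phi x)) : borel X -> R).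
Proof.
apply: measurable_fun_mdist => x0 e e0.
have w1 : 0 < hnorm w + 1 by have := hnorm_ge0 w; lra.
have [|d d0 dP] := embedding_continuous x0 (e := e / (hnorm w + 1)).
  by rewrite divr_gt0.
exists d => // x /dP; rewrite ltr_pdivlMr// => h; rewrite -re_innerBr.
have := cauchy_schwarz w (phi x - phi x0); have := hnorm_ge0 (phi x - phi x0).
nra.
Qed.
End embedding.

(** Applied both to the Gram kernel [<f x, f y>] of one embedding and to
    [<w, phi x (x) psi y>]; a bounded bilinear map is continuous jointly, which is
    what measurability for the product sigma-algebra needs. *)
Lemma measurable_bilinear_embeddings (R : realType) (k1 k2 : scalar_kind)
    (X Y : pmetricType R) (H1 : hilbertType R k1) (H2 : hilbertType R k2)
    (phi : X -> H1) (psi : Y -> H2) (B : H1 -> H2 -> R) (C : R) :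
  separable_space X -> separable_space Y ->
  sqrt_isometric_embedding phi -> sqrt_isometric_embedding psi ->
  (forall u u' v, B (u - u') v = B u v - B u' v) ->
  (forall u v v', B u (v - v') = B u v - B u v') ->
  (forall u v, `|B u v| <= C * (hnorm u * hnorm v)) ->
  measurable_fun setT
    ((fun z => B (phi z.1) (psi z.2)) : (borel X * borel Y)%type -> R).
Proof.
move=> sX sY hphi hpsi Bl Br BC; apply: measurable_fun_mdist_prod => // x0 y0 e e0.
(* if both vectors move by at most r <= 1, B moves by at most (M - 1) r *)
pose M := `|C| * (hnorm (phi x0) + hnorm (psi y0) + 1) + 1.
have [a0 b0] := (hnorm_ge0 (phi x0), hnorm_ge0 (psi y0)).
have C0 := normr_ge0 C.
have M0 : 0 < M by rewrite /M; nra.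
have [|d d0 dP] := embedding_continuous hphi x0 (e := Num.min 1 (e / M)).
  by rewrite lt_min ltr01 divr_gt0.
have [|d' d'0 d'P] := embedding_continuous hpsi y0 (e := Num.min 1 (e / M)).
  by rewrite lt_min ltr01 divr_gt0.
exists (Num.min d d'); first by rewrite lt_min d0 d'0.
move=> x y; rewrite !lt_min => /andP[/dP + _] /andP[_ /d'P].
rewrite !lt_min => /andP[r1 r2] /andP[s1 s2] /=.
set u := phi x - phi x0 in r1 r2 *; set v := psi y - psi y0 in s1 s2 *.
have -> : B (phi x) (psi y) - B (phi x0) (psi y0) =
   B u (psi y) + B (phi x0) v by rewrite Bl Br; ring.
have hy : hnorm (psi y) <= hnorm v + hnorm (psi y0).
  by rewrite -{1}(subrK (psi y0) (psi y)) ler_hnormD.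
have B1 : `|B u (psi y)| <= `|C| * (e / M * (hnorm (psi y0) + 1)).
  rewrite (le_trans (BC _ _))//.
  apply: (@le_trans _ _ (`|C| * (hnorm u * hnorm (psi y)))).
    by rewrite ler_wpM2r ?mulr_ge0 ?hnorm_ge0// ler_norm.
  rewrite ler_wpM2l//; apply: ler_pM; rewrite ?hnorm_ge0 ?(ltW r2)//; lra.
have B2 : `|B (phi x0) v| <= `|C| * (hnorm (phi x0) * (e / M)).
  rewrite (le_trans (BC _ _))//.
  apply: (@le_trans _ _ (`|C| * (hnorm (phi x0) * hnorm v))).
    by rewrite ler_wpM2r ?mulr_ge0 ?hnorm_ge0// ler_norm.
  by rewrite ler_wpM2l// ler_wpM2l// ltW.
apply: (le_lt_trans (ler_normD _ _)); apply: (le_lt_trans (lerD B1 B2)).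
have eM : 0 < e / M by rewrite divr_gt0.
have -> : `|C| * (e / M * (hnorm (psi y0) + 1)) + `|C| * (hnorm (phi x0) * (e / M)) =
    (M - 1) * (e / M) by rewrite /M; ring.
by rewrite mulrBl mul1r mulrC divfK ?gt_eqF// ltrBlDr ltrDl.
Qed.
(** * Integrals for a difference of finite measures *)

Section signed_integral_difference.
Context {d} {T : measurableType d} {R : realType}.
Variables (P Q : {finite_measure set T -> \bar R}) (m : {charge set T -> \bar R}).
Hypothesis mPQ : forall A, measurable A -> m A = (P A - Q A)%E.
Variable f : T -> R.
Hypotheses (intP : P.-integrable setT (EFin \o f))
  (intQ : Q.-integrable setT (EFin \o f)).

Lemma integrable_le_measureD (n : {measure set T -> \bar R}) :
  (forall A, measurable A -> (n A <= P A + Q A)%E) ->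
  n.-integrable setT (EFin \o f).
Proof.
move=> nPQ; have mf := measurable_int _ intP.
have mabsf : measurable_fun setT (fun x => `|(f x)%:E|%E).
  exact: measurableT_comp.
apply/integrableP; split => //.
apply: (@le_lt_trans _ _ (\int[measure_add P Q]_x `|(EFin \o f) x|)%E).
  apply: ge0_le_measure_integral => // A mA.
  by have := nPQ A mA; rewrite -measure_addE.
rewrite ge0_integral_measure_add//.
move/integrableP : intP => [_ ?]; move/integrableP : intQ => [_ ?].
by rewrite lte_add_pinfty.
Qed.

Local Notation hahn_sets := (projT1 (cid (hahn_exists m))).

Lemma pos_partE A : measurable A -> pos_part m A = m (A `&` hahn_sets.1).
Proof. by move=> mA; rewrite [LHS]jordan_posE cjordan_posE /crestr0 mem_set. Qed.

Lemma neg_partE A : measurable A -> neg_part m A = (- m (A `&` hahn_sets.2))%E.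
Proof. by move=> mA; rewrite [LHS]jordan_negE cjordan_negE /crestr0 mem_set. Qed.

(** On the positive Hahn set the subtracted measure only lowers the value; this
    minimality of the Jordan decomposition bounds the total variation by [P + Q]. *)
Lemma pos_part_le A : measurable A -> (pos_part m A <= P A)%E.
Proof.
move=> mA; rewrite pos_partE//; have [[mU _] _ _ _] := hahn m.
have mAU := measurableI _ _ mA mU.
rewrite mPQ// (@le_trans _ _ (P (A `&` hahn_sets.1)))//.
  by rewrite leeBlDr ?fin_num_measure// leeDl.
by rewrite le_measure ?inE.
Qed.

Lemma neg_part_le A : measurable A -> (neg_part m A <= Q A)%E.
Proof.
move=> mA; rewrite neg_partE//; have [_ [mU _] _ _] := hahn m.
have mAU := measurableI _ _ mA mU.
rewrite mPQ// (@le_trans _ _ (Q (A `&` hahn_sets.2)))//.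
  rewrite fin_num_oppeB ?fin_num_measure//.
  by rewrite addeC leeBlDr ?fin_num_measure// leeDl.
by rewrite le_measure ?inE.
Qed.

(** [P - Q] and the Jordan decomposition of [m] describe the same charge, so the
    measures [P + neg_part m] and [Q + pos_part m] coincide; integrating [f]
    against both and rearranging gives the formula. *)
Lemma signed_integral_diff : signed_integrable m f /\
  signed_integral m f = \int[P]_x f x - \int[Q]_x f x.
Proof.
have intp : (pos_part m).-integrable setT (EFin \o f).
  apply: integrable_le_measureD => A mA.
  by rewrite (le_trans (pos_part_le mA))// leeDl.
have intn : (neg_part m).-integrable setT (EFin \o f).
  apply: integrable_le_measureD => A mA.
  by rewrite (le_trans (neg_part_le mA))// leeDr.
split.
  apply: integrable_le_measureD => A mA.
  by rewrite /total_variation/= leeD// ?pos_part_le// neg_part_le.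
have mf := measurable_int _ intP.
have : (\int[measure_add P (neg_part m)]_x (f x)%:E =
        \int[measure_add Q (pos_part m)]_x (f x)%:E)%E.
  apply: eq_measure_integral => A mA _.
  have PE : (P A - Q A = pos_part m A - neg_part m A)%E.
    by rewrite -mPQ// (jordan_decomp (hahn m) mA) /cadd/= cscaleN1.
  transitivity (P A + neg_part m A)%E; first exact: measure_addE.
  transitivity (Q A + pos_part m A)%E; last exact/esym/measure_addE.
  have : P A \is a fin_num by exact: fin_num_measure.
  have : Q A \is a fin_num by exact: fin_num_measure.
  have : pos_part m A \is a fin_num.
    rewrite pos_partE// fin_num_measure//.
    by apply: measurableI => //; case: (hahn m) => -[].
  have : neg_part m A \is a fin_num.
    rewrite neg_partE// fin_numN fin_num_measure//.
    by apply: measurableI => //; case: (hahn m) => _ [].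
  move: PE; case: (P A) (Q A) (pos_part m A) (neg_part m A)
    => [a| |] [b| |] [p| |] [n| |]//=.
  by move=> [ab] _ _ _ _; congr EFin; lra.
rewrite !integral_measure_add// => h.
apply/eqP; rewrite /signed_integral subr_eq addrAC eq_sym subr_eq; apply/eqP.
rewrite /Rintegral -!fineD ?integrable_fin_num//; congr fine.
by rewrite h addeC.
Qed.
End signed_integral_difference.
(** * Weak integrals and the Pettis integral *)

Lemma integrable_dominated d (T : measurableType d) (R : realType)
    (P : {measure set T -> \bar R}) (f g : T -> R) :
  measurable_fun setT f -> (forall x, `|f x| <= g x) ->
  P.-integrable setT (EFin \o g) -> P.-integrable setT (EFin \o f).
Proof.
move=> mf fg intg; apply: (le_integrable measurableT _ _ intg).
  exact/measurable_EFinP.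
by move=> x _ /=; rewrite lee_fin (le_trans (fg x))// ler_norm.
Qed.

Section weak_integral.
Context {d} {T : measurableType d} {R : realType} {k : scalar_kind}
  {H : hilbertType R k}.

(** The Pettis integral of [f] under a nonnegative measure, tested only on the
    functionals [re_inner w].  By Riesz these are all bounded real-linear
    functionals; the form also makes sense over complex scalars, where it
    describes the integral in the underlying real Hilbert space. *)
Definition weak_integral (P : {measure set T -> \bar R}) (f : T -> H) (v : H) :=
  forall w, P.-integrable setT (EFin \o (fun x => re_inner w (f x))) /\
    re_inner w v = \int[P]_x re_inner w (f x).

(** Riesz representation of the functional [w |-> \int <w, f>], which is bounded
    by the integral of the dominating function [g]. *)
Lemma weak_integral_exists (P : {measure set T -> \bar R}) (f : T -> H)
    (g : T -> R) :
  (forall w, measurable_fun setT (fun x => re_inner w (f x))) ->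
  P.-integrable setT (EFin \o g) -> (forall x, hnorm (f x) <= g x) ->
  exists v, weak_integral P f v.
Proof.
move=> mf intg fg.
have bound w x : `|re_inner w (f x)| <= hnorm w * g x.
  by rewrite (le_trans (cauchy_schwarz _ _))// ler_wpM2l ?hnorm_ge0.
have intwg (w : H) : P.-integrable setT (EFin \o (fun x => hnorm w * g x)).
  exact: (integrableZl measurableT (hnorm w) intg).
have intf w : P.-integrable setT (EFin \o (fun x => re_inner w (f x))).
  exact: integrable_dominated (mf w) (bound w) (intwg w).
have [|||v vP] := @riesz _ _ H (fun w => \int[P]_x re_inner w (f x)) (\int[P]_x g x).
- move=> u v; rewrite -RintegralD//; apply: eq_Rintegral => x _.
  by rewrite re_innerDl.
- move=> a u; rewrite -RintegralZl//; apply: eq_Rintegral => x _.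
  by rewrite re_innerZl.
- move=> u; apply: (le_trans (le_normr_Rintegral measurableT (intf u))).
  rewrite mulrC -RintegralZl//; apply: le_Rintegral => //.
  have := integrable_abse (intf u); exact.
by exists v => w; split => //; rewrite -vP.
Qed.

End weak_integral.

Section pettis.
Context {d} {T : measurableType d} {R : realType} {HT : hilbertType R RealScalars}.

(** Links the functionals quantified over in the definition of the Pettis
    integral with the test vectors of [weak_integral]. *)
Lemma riesz_continuous (h : {linear HT -> (scalar_field R RealScalars)^o}) :
  continuous h -> exists w, forall u, h u = re_inner w u.
Proof.
move=> hc; have /linear_boundedP[C [Creal CP]] :=
  continuous_linear_bounded (0 : HT) (hc 0).
have [|||w wP] := @riesz R RealScalars HT h (C + 1).
- by move=> u v; rewrite linearD.
- by move=> a u; rewrite linearZ.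
- by move=> u; apply: CP; rewrite ltrDl.
by exists w => u; rewrite wP re_innerC.
Qed.

(** A named copy of [re_inner], with the codomain used for functionals, to carry
    the linear structure. *)
Definition re_inner_fun (w : HT) : HT -> (scalar_field R RealScalars)^o :=
  re_inner w.

Lemma re_inner_fun_linear w : linear (re_inner_fun w).
Proof. by move=> a u v; rewrite /re_inner_fun re_innerDr re_innerZr. Qed.

HB.instance Definition _ w := GRing.isLinear.Build _ _ _ _ _ (re_inner_fun_linear w).

Lemma re_inner_fun_continuous w : continuous (re_inner_fun w).
Proof.
apply/linear_bounded_continuous/linear_boundedP.
exists (hnorm w); split; first exact: num_real.
move=> C wC u; apply: (le_trans (cauchy_schwarz w u)).
by apply: ler_wpM2r; [exact: hnorm_ge0|exact: ltW].
Qed.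

(** The chosen Pettis integral is pinned down because the functionals
    [re_inner w] separate vectors. *)
Lemma pettis_integral_diff (P Q : {finite_measure set T -> \bar R})
    (m : {charge set T -> \bar R}) (f : T -> HT) v v' :
  (forall A, measurable A -> m A = (P A - Q A)%E) ->
  weak_integral P f v -> weak_integral Q f v' ->
  pettis_integral m f = v - v'.
Proof.
move=> mPQ fv fv'; apply: get_unique.
  move=> h /riesz_continuous[w hw].
  have [i1 e1] := fv w; have [i2 e2] := fv' w.
  have [im em] := signed_integral_diff mPQ i1 i2.
  have -> : (h \o f : T -> R) = (fun x => re_inner w (f x)).
    by apply/funext => x; exact: hw.
  split; first split => //.
    (* the imaginary part of a real scalar is the constant 0 *)
    have i0 (n : {finite_measure set T -> \bar R}) :
        n.-integrable setT (EFin \o (fun=> 0 : R)).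
      exact: finite_measure_integrable_cst.
    by have [] := signed_integral_diff mPQ (i0 P) (i0 Q).
  by rewrite hw re_innerBr e1 e2 -em.
move=> z zP; apply/eqP; rewrite -subr_eq0; apply/eqP/re_inner_eq0 => w.
have [i1 e1] := fv w; have [i2 e2] := fv' w.
have [im em] := signed_integral_diff mPQ i1 i2.
have zE : re_inner w z = signed_integral m (fun x => re_inner w (f x)).
  exact: (zP (re_inner_fun w) (@re_inner_fun_continuous w)).2.
by rewrite !re_innerBr zE em e1 e2 subrr.
Qed.

Lemma pettis_integral_finite_measure (P : {finite_measure set T -> \bar R})
    (f : T -> HT) v :
  weak_integral P f v -> pettis_integral (charge_of_finite_measure P) f = v.
Proof.
move=> fv; rewrite -[RHS]subr0.
apply: (@pettis_integral_diff P mzero) => //.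
  by move=> A mA; rewrite /= /mzero sube0.
move=> w; split.
  apply/integrableP; split; first exact: measurable_int (fv w).1.
  by rewrite integral_measure_zero.
by rewrite re_inner0r /Rintegral integral_measure_zero.
Qed.
End pettis.
(** * Calculus of weak integrals *)

Lemma Rintegral_cst_probability d (T : measurableType d) (R : realType)
    (P : probability T R) (c : R) : \int[P]_x c = c.
Proof.
rewrite Rintegral_cst//.
have -> : fine (P setT) = 1 by rewrite probability_setT.
by rewrite mulr1.
Qed.

Section weak_integral_theory.
Context {R : realType} {k : scalar_kind} {H : hilbertType R k}.
Context {d} {T : measurableType d}.

Lemma weak_integralB (P : {measure set T -> \bar R}) (f g : T -> H) u v :
  weak_integral P f u -> weak_integral P g v ->
  weak_integral P (fun x => f x - g x) (u - v).
Proof.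
move=> fu gv w; have [i1 e1] := fu w; have [i2 e2] := gv w.
have -> : (fun x => re_inner w (f x - g x)) =
    (fun x => re_inner w (f x) - re_inner w (g x)).
  by apply/funext => x; rewrite re_innerBr.
split; first exact: (integrableB measurableT i1 i2).
by rewrite re_innerBr e1 e2 RintegralB.
Qed.

Lemma weak_integral_cst (P : probability T R) (c : H) :
  weak_integral P (fun=> c) c.
Proof.
move=> w; split; first exact: finite_measure_integrable_cst.
by rewrite Rintegral_cst_probability.
Qed.

(** By Riesz the functional [<w, A u>] of [u] is the inner product with some
    vector, the adjoint of [A] applied to [w], so that testing [A \o f] against
    [w] is testing [f] against that vector. *)
Lemma weak_integral_map {k' : scalar_kind} {H' : hilbertType R k'}
    (P : {measure set T -> \bar R}) (f : T -> H) (A : H -> H') (C : R) v :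
  (forall u u', A (u + u') = A u + A u') ->
  (forall a u, A (mkscalar k a 0 *: u) = mkscalar k' a 0 *: A u) ->
  (forall u, hnorm (A u) <= C * hnorm u) ->
  weak_integral P f v -> weak_integral P (A \o f) (A v).
Proof.
move=> AD AZ AC fv w.
have [|||u uP] := @riesz _ _ H (fun u => re_inner w (A u)) (hnorm w * C).
- by move=> u u'; rewrite AD re_innerDr.
- by move=> a u; rewrite AZ re_innerZr.
- move=> u; rewrite (le_trans (cauchy_schwarz _ _))// -mulrA.
  by rewrite ler_wpM2l ?hnorm_ge0.
have -> : (fun x => re_inner w ((A \o f) x)) = (fun x => re_inner u (f x)).
  by apply/funext => x; rewrite /= uP re_innerC.
by rewrite uP re_innerC; exact: fv.
Qed.

(** [Q] is only assumed to agree with the image measure on measurable sets, which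
    lets a separately given marginal be used in place of a pushforward. *)
Lemma integrable_map {d'} {T' : measurableType d'} (P : {measure set T -> \bar R})
    (Q : {measure set T' -> \bar R}) (g : T -> T') (F : T' -> R) :
  measurable_fun setT g -> (forall A, measurable A -> Q A = P (g @^-1` A)) ->
  Q.-integrable setT (EFin \o F) ->
  P.-integrable setT (EFin \o (F \o g)) /\
  \int[P]_x F (g x) = \int[Q]_y F y.
Proof.
move=> mg QP intF; have mF := measurable_int _ intF.
have intFg : P.-integrable setT (EFin \o (F \o g)).
  apply/integrableP; split; first exact: (measurableT_comp mF mg).
  have [_] := integrableP _ _ _ intF.
  rewrite (eq_measure_integral (pushforward P g)); last first.
    by move=> A mA _; exact: QP.
  rewrite ge0_integral_pushforward//; exact: measurableT_comp.
split => //; rewrite /Rintegral; congr fine.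
rewrite [RHS](eq_measure_integral (pushforward P g)); last first.
  by move=> A mA _; exact: QP.
by rewrite (integral_pushforward mg mF).
Qed.

Lemma weak_integral_comp {d'} {T' : measurableType d'}
    (P : {measure set T -> \bar R}) (Q : {measure set T' -> \bar R}) (g : T -> T')
    (f : T' -> H) v :
  measurable_fun setT g -> (forall A, measurable A -> Q A = P (g @^-1` A)) ->
  weak_integral Q f v -> weak_integral P (f \o g) v.
Proof.
move=> mg QP fv w; have [i e] := fv w.
by have [i' e'] := integrable_map mg QP i; split => //; rewrite e'.
Qed.
End weak_integral_theory.

(** * One embedding: means and the centred metric *)

Section one_embedding.
Context {R : realType} {k : scalar_kind} {X : pmetricType R} {H : hilbertType R k}.
Implicit Types phi : X -> H.

Lemma measurable_hnorm_embedding phi : sqrt_isometric_embedding phi ->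
  measurable_fun setT ((fun x => hnorm (phi x)) : borel X -> R).
Proof.
move=> hphi; apply: measurable_fun_mdist => x0 e e0.
have [d d0 dP] := embedding_continuous hphi x0 e0.
exists d => // x /dP; apply: le_lt_trans.
have := ler_hnormD (phi x - phi x0) (phi x0); rewrite subrK => h1.
have := ler_hnormD (phi x0 - phi x) (phi x); rewrite subrK => h2.
rewrite -(hnorm_opp (phi x0 - _)) opprB in h2.
by rewrite ler_norml; apply/andP; split; lra.
Qed.

(** The squared norm is dominated by [2 mdist x x0 + 2 |phi x0|^2], so first
    moments of the metric are second moments of the embedding. *)
Lemma integrable_hnorm_sq (mu : probability (borel X) R) phi :
  sqrt_isometric_embedding phi -> finite_first_moment mu ->
  mu.-integrable setT (EFin \o (fun x => hnorm (phi x) ^+ 2)).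
Proof.
move=> hphi [x0 x0P].
have mn := measurable_hnorm_embedding hphi.
have id_ : mu.-integrable setT (EFin \o (fun x : borel X => mdist (x : X) x0)).
  apply/integrableP; split.
    apply/measurable_EFinP.
    under eq_fun do rewrite hphi.
    apply: measurable_funX.
    exact: (measurable_hnorm_embedding (embeddingB hphi (phi x0))).
  by under eq_integral do rewrite /= ger0_norm ?mdist_ge0//.
apply: (@integrable_dominated _ _ _ _ _
  (fun x : borel X => 2 * mdist (x : X) x0 + 2 * hnorm (phi x0) ^+ 2)).
- exact: measurable_funX.
- move=> x; rewrite ger0_norm ?sqr_ge0// hphi -!re_inner_sq.
  have := re_inner_ge0 (phi x - phi x0 - phi x0).
  rewrite !(re_innerBl, re_innerBr) (re_innerC (phi x0) (phi x)); lra.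
exact: (integrableD measurableT (integrableZl measurableT 2 id_)
  (finite_measure_integrable_cst mu _ measurableT)).
Qed.

Lemma mean_exists (mu : probability (borel X) R) phi :
  sqrt_isometric_embedding phi -> finite_first_moment mu ->
  exists m, weak_integral mu phi m.
Proof.
move=> hphi mu1.
apply: (@weak_integral_exists _ _ _ _ _ mu phi (fun x => hnorm (phi x) ^+ 2 + 1)).
- by move=> w; exact: measurable_re_inner_embedding.
- exact: (integrableD measurableT (integrable_hnorm_sq hphi mu1)
    (finite_measure_integrable_cst mu 1 measurableT)).
- by move=> x; nra.
Qed.

(** With [f = phi - m], which is an embedding of weak integral 0, the metric is
    [|f x|^2 + |f y|^2 - 2 <f x, f y>].  Integrating in [y] kills the cross term,
    so the averages [mean_dist] and [mean_mean_dist] cancel both squares. *)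
Lemma centered_distE (mu : probability (borel X) R) phi m x1 x2 :
  sqrt_isometric_embedding phi -> finite_first_moment mu ->
  weak_integral mu phi m ->
  centered_dist mu x1 x2 = - 2 * re_inner (phi x1 - m) (phi x2 - m).
Proof.
move=> hphi mu1 phim; set f := fun x => phi x - m.
have hf : sqrt_isometric_embedding f := embeddingB hphi m.
have f0 : weak_integral mu f 0.
  by rewrite -(subrr m); exact: weak_integralB (weak_integral_cst mu m).
have intf2 := integrable_hnorm_sq hf mu1.
pose V := \int[mu]_y hnorm (f y) ^+ 2.
have intc (c : R) : mu.-integrable setT (EFin \o (fun=> c)).
  exact: finite_measure_integrable_cst.
have distE x y : mdist x y = hnorm (f x) ^+ 2 + hnorm (f y) ^+ 2 -
      2 * re_inner (f x) (f y).
  rewrite hf -!re_inner_sq; move: (f x) (f y) => a b.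
  by rewrite !(re_innerBl, re_innerBr) (re_innerC b a); ring.
have int1 x : mu.-integrable setT
    (EFin \o (fun y => hnorm (f x) ^+ 2 + hnorm (f y) ^+ 2)).
  exact: (integrableD measurableT (intc (hnorm (f x) ^+ 2)) intf2).
have meanE x : mean_dist mu x = hnorm (f x) ^+ 2 + V.
  have [i e] := f0 (f x).
  rewrite /mean_dist; under eq_Rintegral do rewrite distE.
  rewrite RintegralB//; last exact: (integrableZl measurableT 2 i).
  rewrite RintegralZl// -e re_inner0r mulr0 subr0 RintegralD//.
  by rewrite Rintegral_cst_probability.
have meanmeanE : mean_mean_dist mu = V + V.
  rewrite /mean_mean_dist; under eq_Rintegral do rewrite meanE.
  by rewrite RintegralD// Rintegral_cst_probability.
by rewrite /centered_dist meanmeanE !meanE distE; ring.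
Qed.
End one_embedding.
(** * Integrals on product spaces *)

(** The pointwise integrability of the sections is needed because a real-valued
    integral turns an infinite inner integral into 0. *)
Lemma Rintegral_prod d1 d2 (T1 : measurableType d1) (T2 : measurableType d2)
    (R : realType) (P : probability T1 R) (Q : probability T2 R)
    (f : T1 * T2 -> R) :
  (P \x Q)%E.-integrable setT (EFin \o f) ->
  (forall x, Q.-integrable setT (EFin \o (fun y => f (x, y)))) ->
  \int[(P \x Q)%E]_z f z = \int[P]_x \int[Q]_y f (x, y).
Proof.
move=> intf intfx; rewrite /Rintegral -integral12_prod_meas1//; congr fine.
apply: eq_integral => x _; rewrite /fubini_F fineK//.
exact: (integrable_fin_num measurableT (intfx x)).
Qed.

Lemma integrable_prod_mul d1 d2 (T1 : measurableType d1) (T2 : measurableType d2)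
    (R : realType) (P : probability T1 R) (Q : probability T2 R)
    (f : T1 -> R) (g : T2 -> R) :
  P.-integrable setT (EFin \o f) -> Q.-integrable setT (EFin \o g) ->
  (P \x Q)%E.-integrable setT (EFin \o (fun z => f z.1 * g z.2)).
Proof.
move=> intf intg.
have mf : measurable_fun setT f.
  by apply/measurable_EFinP; exact: measurable_int intf.
have mg : measurable_fun setT g.
  by apply/measurable_EFinP; exact: measurable_int intg.
apply/integrable12ltyP.
  apply/measurable_EFinP; apply: measurable_funM.
    exact: (measurableT_comp mf measurable_fst).
  exact: (measurableT_comp mg measurable_snd).
have [_ fy] := integrableP _ _ _ intf; have [_ gy] := integrableP _ _ _ intg.
under eq_integral => x _.
  under eq_integral => y _ do rewrite /= normrM EFinM.
  rewrite ge0_integralZl//; last first.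
    by apply/measurable_EFinP; exact: measurableT_comp.
  over.
rewrite ge0_integralZr//.
- apply: lte_mul_pinfty; [exact: integral_ge0| |exact: gy].
  by rewrite ge0_fin_numE//; exact: integral_ge0.
- by apply/measurable_EFinP; exact: measurableT_comp.
- exact: integral_ge0.
Qed.

(** * The tensor map *)

Section tensor.
Context {R : realType} {k : scalar_kind} {H1 H2 : hilbertType R k}
  {HT : hilbertType R RealScalars} (tens : H1 -> H2 -> HT).
Hypothesis htens : is_hilbert_tensor tens.

Lemma re_inner_tens u v u' v' :
  re_inner (tens u v) (tens u' v') = re_inner u u' * re_inner v v'.
Proof. by have [_ inn _] := htens; rewrite /re_inner inn. Qed.

Lemma hnorm_tens u v : hnorm (tens u v) = hnorm u * hnorm v.
Proof.
apply/eqP; rewrite -(@eqrXn2 _ 2%N) ?mulr_ge0 ?hnorm_ge0//.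
by rewrite exprMn -!re_inner_sq re_inner_tens.
Qed.

Lemma tensZDl a u u' v :
  tens (mkscalar k a 0 *: u + u') v =
    mkscalar RealScalars a 0 *: tens u v + tens u' v.
Proof. by have [[]] := htens. Qed.

Lemma tensZDr a u v v' :
  tens u (mkscalar k a 0 *: v + v') =
    mkscalar RealScalars a 0 *: tens u v + tens u v'.
Proof. by have [[]] := htens. Qed.

Lemma tensDl u u' v : tens (u + u') v = tens u v + tens u' v.
Proof.
by rewrite -[u in LHS]scale1r -(@mkscalar1 R k) tensZDl mkscalar1 scale1r.
Qed.

Lemma tensDr u v v' : tens u (v + v') = tens u v + tens u v'.
Proof.
by rewrite -[v in LHS]scale1r -(@mkscalar1 R k) tensZDr mkscalar1 scale1r.
Qed.

Lemma tens0l v : tens 0 v = 0.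
Proof. by apply: (addrI (tens 0 v)); rewrite -tensDl !addr0. Qed.

Lemma tens0r u : tens u 0 = 0.
Proof. by apply: (addrI (tens u 0)); rewrite -tensDr !addr0. Qed.

Lemma tensZl a u v :
  tens (mkscalar k a 0 *: u) v = mkscalar RealScalars a 0 *: tens u v.
Proof. by rewrite -[_ *: u]addr0 tensZDl tens0l addr0. Qed.

Lemma tensZr a u v :
  tens u (mkscalar k a 0 *: v) = mkscalar RealScalars a 0 *: tens u v.
Proof. by rewrite -[_ *: v]addr0 tensZDr tens0r addr0. Qed.

Lemma tensBl u u' v : tens (u - u') v = tens u v - tens u' v.
Proof. by apply: (addIr (tens u' v)); rewrite -tensDl !subrK. Qed.

Lemma tensBr u v v' : tens u (v - v') = tens u v - tens u v'.
Proof. by apply: (addIr (tens u v')); rewrite -tensDr !subrK. Qed.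

Lemma weak_integral_tensl {d} {T : measurableType d} (P : {measure set T -> \bar R})
    (f : T -> H1) u v :
  weak_integral P f u -> weak_integral P (fun x => tens (f x) v) (tens u v).
Proof.
apply: (@weak_integral_map _ _ _ _ _ _ _ _ _ (tens^~ v) (hnorm v)).
- by move=> ? ?; rewrite tensDl.
- by move=> ? ?; rewrite tensZl.
- by move=> ?; rewrite hnorm_tens mulrC.
Qed.

Lemma weak_integral_tensr {d} {T : measurableType d} (P : {measure set T -> \bar R})
    (f : T -> H2) u v :
  weak_integral P f v -> weak_integral P (fun x => tens u (f x)) (tens u v).
Proof.
apply: (@weak_integral_map _ _ _ _ _ _ _ _ _ (tens u) (hnorm u)).
- by move=> ? ?; rewrite tensDr.
- by move=> ? ?; rewrite tensZr.
- by move=> ?; rewrite hnorm_tens.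
Qed.
End tensor.

(** * Integrating the tensor product of two embeddings *)

Section tensor_embedding.
Context {R : realType} {k : scalar_kind} {X Y : pmetricType R}.
Context {H1 H2 : hilbertType R k} {HT : hilbertType R RealScalars}.
Variable tens : H1 -> H2 -> HT.
Hypothesis htens : is_hilbert_tensor tens.
Hypotheses (sepX : separable_space X) (sepY : separable_space Y).
Variables (mu : probability (borel X) R) (nu : probability (borel Y) R).
Hypotheses (mu1 : finite_first_moment mu) (nu1 : finite_first_moment nu).

(** An arbitrary coupling of the two marginals is considered, because the results
    serve both the joint distribution and the product of its marginals. *)
Section coupling.
Variable theta : probability (borel X * borel Y)%type R.
Hypotheses (muE : forall A, measurable A -> mu A = theta (fst @^-1` A))
  (nuE : forall B, measurable B -> nu B = theta (snd @^-1` B)).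
Variables (phi : X -> H1) (psi : Y -> H2).
Hypotheses (hphi : sqrt_isometric_embedding phi)
  (hpsi : sqrt_isometric_embedding psi).

Let F (z : borel X * borel Y) := tens (phi z.1) (psi z.2).

Lemma measurable_tensor_embedding w :
  measurable_fun setT (fun z => re_inner w (F z)).
Proof.
apply: (@measurable_bilinear_embeddings _ _ _ _ _ _ _ _ _
  (fun u v => re_inner w (tens u v)) (hnorm w)) => //.
- by move=> u u' v; rewrite tensBl// re_innerBr.
- by move=> u v v'; rewrite tensBr// re_innerBr.
- by move=> u v; rewrite (le_trans (cauchy_schwarz _ _))// hnorm_tens.
Qed.

Let dom (z : borel X * borel Y) := hnorm (phi z.1) ^+ 2 + hnorm (psi z.2) ^+ 2.

Lemma hnorm_tensor_embedding_le z : hnorm (F z) <= dom z.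
Proof. by rewrite hnorm_tens// /dom; nra. Qed.

Lemma integrable_coupling_sq : theta.-integrable setT (EFin \o dom).
Proof.
have [i1 _] := integrable_map measurable_fst muE (integrable_hnorm_sq hphi mu1).
have [i2 _] := integrable_map measurable_snd nuE (integrable_hnorm_sq hpsi nu1).
exact: (integrableD measurableT i1 i2).
Qed.

Lemma tensor_integral_exists : exists b, weak_integral theta F b.
Proof.
exact: (weak_integral_exists measurable_tensor_embedding integrable_coupling_sq
  hnorm_tensor_embedding_le).
Qed.

Let kernel (z : (borel X * borel Y) * (borel X * borel Y)) :=
  re_inner (phi z.1.1) (phi z.2.1) * re_inner (psi z.1.2) (psi z.2.2).

Let kernelE z : kernel z = re_inner (F z.1) (F z.2).
Proof. by rewrite re_inner_tens. Qed.

(** Cauchy-Schwarz separates the two points of [theta \x theta], so the kernel is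
    dominated by a product of two functions integrable under [theta]; a bound by
    a sum of squared norms of tensors would call for higher moments. *)
Lemma integrable_tensor_kernel :
  (theta \x theta)%E.-integrable setT (EFin \o kernel).
Proof.
have mK (Z : pmetricType R) (K : hilbertType R k) (f : Z -> K) :
    separable_space Z -> sqrt_isometric_embedding f ->
    measurable_fun setT
      ((fun z => re_inner (f z.1) (f z.2)) : (borel Z * borel Z)%type -> R).
  move=> sepZ hf; apply: (@measurable_bilinear_embeddings _ _ _ _ _ _ _ _ _
    (fun u v => re_inner u v) 1) => //.
  - by move=> u u' v; rewrite re_innerBl.
  - by move=> u v v'; rewrite re_innerBr.
  - by move=> u v; rewrite mul1r cauchy_schwarz.
apply: integrable_dominated _ _
  (integrable_prod_mul integrable_coupling_sq integrable_coupling_sq).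
- apply: measurable_funM.
    apply: (measurableT_comp (mK _ _ _ sepX hphi)
      (g := fun z : (borel X * borel Y) * (borel X * borel Y) => (z.1.1, z.2.1))).
    exact: (measurable_fun_pair (measurableT_comp measurable_fst measurable_fst)
      (measurableT_comp measurable_fst measurable_snd)).
  apply: (measurableT_comp (mK _ _ _ sepY hpsi)
    (g := fun z : (borel X * borel Y) * (borel X * borel Y) => (z.1.2, z.2.2))).
  exact: (measurable_fun_pair (measurableT_comp measurable_snd measurable_fst)
    (measurableT_comp measurable_snd measurable_snd)).
- move=> z; rewrite kernelE (le_trans (cauchy_schwarz _ _))//.
  by rewrite ler_pM ?hnorm_ge0 ?hnorm_tensor_embedding_le.
Qed.

(** [|b|^2 = <b, b>]: unfold the weak integral [b] once in each argument. *)
Lemma hnorm_tensor_integral b : weak_integral theta F b ->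
  hnorm b ^+ 2 = \int[(theta \x theta)%E]_z kernel z.
Proof.
move=> Fb; rewrite Rintegral_prod; first last.
- move=> z; have [i _] := Fb (F z).
  by rewrite (_ : (fun y => kernel (z, y)) = (fun y => re_inner (F z) (F y)))//;
    apply/funext => y; rewrite kernelE.
- exact: integrable_tensor_kernel.
rewrite -re_inner_sq (Fb b).2; apply: eq_Rintegral => z _.
by rewrite re_innerC (Fb (F z)).2; apply: eq_Rintegral => y _; rewrite kernelE.
Qed.
End coupling.

(** Under the product measure the two factors can be averaged separately, first
    in [y] with [x] fixed, then in [x]. *)
Lemma tensor_integral_prod phi psi m n :
  sqrt_isometric_embedding phi -> sqrt_isometric_embedding psi ->
  weak_integral mu phi m -> weak_integral nu psi n ->
  weak_integral (prod_probability mu nu)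
    (fun z : borel X * borel Y => tens (phi z.1) (psi z.2)) (tens m n).
Proof.
move=> hphi hpsi phim psin.
have muE A : measurable A -> mu A = prod_probability mu nu (fst @^-1` A).
  move=> mA; have -> : fst @^-1` A = A `*` setT :> set (borel X * borel Y).
    by apply/seteqP; split => z //= -[].
  rewrite [RHS]product_measure1E// -[LHS]mule1; congr (_ * _)%E.
  exact/esym/probability_setT.
have nuE A : measurable A -> nu A = prod_probability mu nu (snd @^-1` A).
  move=> mA; have -> : snd @^-1` A = setT `*` A :> set (borel X * borel Y).
    by apply/seteqP; split => z //= -[].
  rewrite [RHS]product_measure1E// -[LHS]mul1e; congr (_ * _)%E.
  exact/esym/probability_setT.
have [b Fb] := tensor_integral_exists muE nuE hphi hpsi.
move=> w; split; first exact: (Fb w).1.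
rewrite Rintegral_prod; last 2 first.
- exact: (Fb w).1.
- by move=> x; exact: (weak_integral_tensr htens (phi x) psin w).1.
rewrite (weak_integral_tensl htens n phim w).2; apply: eq_Rintegral => x _.
by rewrite (weak_integral_tensr htens (phi x) psin w).2.
Qed.

(** Centre the two factors one after the other:
    [(phi - m) (x) (psi - n) = phi (x) psi - m (x) (psi - n) - phi (x) n].
    The middle term has integral 0 and the last one has integral [m (x) n]. *)
Lemma centered_tensor_integral (theta : probability (borel X * borel Y)%type R)
    phi psi m n b :
  (forall A, measurable A -> mu A = theta (fst @^-1` A)) ->
  (forall B, measurable B -> nu B = theta (snd @^-1` B)) ->
  weak_integral mu phi m -> weak_integral nu psi n ->
  weak_integral theta (fun z : borel X * borel Y => tens (phi z.1) (psi z.2)) b ->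
  weak_integral theta
    (fun z : borel X * borel Y => tens (phi z.1 - m) (psi z.2 - n)) (b - tens m n).
Proof.
move=> muE nuE phim psin Fb.
have c1 := weak_integral_tensr htens m
  (weak_integralB psin (weak_integral_cst nu n)).
have c2 := weak_integral_tensl htens n phim.
have d1 := weak_integral_comp measurable_snd nuE c1.
have d2 := weak_integral_comp measurable_fst muE c2.
have := weak_integralB (weak_integralB Fb d1) d2.
rewrite subrr tens0r// subr0.
congr weak_integral; apply/funext => z /=.
rewrite (tensBl htens) (tensBr htens (phi z.1)) addrAC.
by [].
Qed.
End tensor_embedding.
(** * Distance covariance as a squared norm *)

(** The integrals forming [centered_dist] see a measure only through its values
    on measurable sets; this passes from marginals to the given [mu] and [nu]. *)
Lemma eq_centered_dist (R : realType) (X : pmetricType R)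
    (m1 m2 : {measure set (borel X) -> \bar R}) :
  (forall A, measurable A -> m1 A = m2 A) -> centered_dist m1 = centered_dist m2.
Proof.
move=> m12.
have eqI (f : borel X -> R) : \int[m1]_x f x = \int[m2]_x f x.
  by rewrite /Rintegral (eq_measure_integral m2)// => A mA _; exact: m12.
have eqM x : mean_dist m1 x = mean_dist m2 x by exact: eqI.
apply/funext => x; apply/funext => y; rewrite /centered_dist !eqM.
by rewrite /mean_mean_dist eqI; under eq_Rintegral do rewrite eqM.
Qed.

Theorem theorem3p15 (R : realType) (k : scalar_kind) (X Y : pmetricType R)
    (H1 H2 : hilbertType R k) (HT : hilbertType R RealScalars)
    (tens : H1 -> H2 -> HT) (htens : is_hilbert_tensor tens)
    (sepX : separable_space X) (sepY : separable_space Y)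
    (negX : negative_type X) (negY : negative_type Y)
    (sepH1 : separable_space H1) (sepH2 : separable_space H2)
    (phi : X -> H1) (psi : Y -> H2)
    (hphi : sqrt_isometric_embedding phi) (hpsi : sqrt_isometric_embedding psi)
    (theta : probability (borel X * borel Y)%type R)
    (htheta : in_M11 (charge_of_finite_measure theta))
    (mu : probability (borel X) R) (nu : probability (borel Y) R)
    (muE : forall A, measurable A -> mu A = fst_marginal theta A)
    (nuE : forall B, measurable B -> nu B = snd_marginal theta B)
    (hmu : finite_first_moment mu) (hnu : finite_first_moment nu) :
  dcov theta =
    4 * hnorm (beta_tensor tens phi psi
                 (csub (charge_of_finite_measure theta)
                       (charge_of_finite_measure (prod_probability mu nu)))) ^+ 2 /\
  4 * hnorm (beta_tensor tens phi psi
               (csub (charge_of_finite_measure theta)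
                     (charge_of_finite_measure (prod_probability mu nu)))) ^+ 2 =
    4 * hnorm
      (pettis_integral (charge_of_finite_measure theta)
         (fun z : borel X * borel Y => tens (phi z.1) (psi z.2)) -
       pettis_integral (charge_of_finite_measure (prod_probability mu nu))
         (fun z : borel X * borel Y => tens (phi z.1) (psi z.2))) ^+ 2.
Proof.
have [m phim] := mean_exists hphi hmu.
have [n psin] := mean_exists hpsi hnu.
have [b Fb] := tensor_integral_exists htens sepX sepY hmu hnu muE nuE hphi hpsi.
have Fmn := tensor_integral_prod htens sepX sepY hmu hnu hphi hpsi phim psin.
have Gb := centered_tensor_integral htens muE nuE phim psin Fb.
have betaE : beta_tensor tens phi psi
    (csub (charge_of_finite_measure theta)
      (charge_of_finite_measure (prod_probability mu nu))) = b - tens m n.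
  by apply: pettis_integral_diff Fb Fmn => A mA.
rewrite betaE (pettis_integral_finite_measure Fb).
rewrite (pettis_integral_finite_measure Fmn).
split => //.
rewrite (hnorm_tensor_integral htens sepX sepY hmu hnu muE nuE
  (embeddingB hphi m) (embeddingB hpsi n) Gb).
rewrite -RintegralZl//; last first.
  exact: (integrable_tensor_kernel htens sepX sepY hmu hnu muE nuE
    (embeddingB hphi m) (embeddingB hpsi n)).
rewrite /dcov; apply: eq_Rintegral => z _.
rewrite -(eq_centered_dist muE) -(eq_centered_dist nuE).
rewrite (centered_distE _ _ hphi hmu phim) (centered_distE _ _ hpsi hnu psin).
ring.
Qed.
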